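(* Let $q\ge 2$ be an integer and let $p_0,\dots,p_{q-1}$ be non-negative real numbers with $\sum_{j=0}^{q-1}p_j=1$ and $p_j\neq 1$ for every $j$. Let $x_1,x_2,\dots$ be independent, identically distributed random variables with values in $\{0,\dots,q-1\}$ and $\mathbb{P}[x_i=j]=p_j$ for all $i\ge 1$ and $j\in\{0,\dots,q-1\}$. Put $X=\sum_{i=1}^\infty x_i q^{-i}$ and let $F(x)=\mathbb{P}[X\le x]$ be the distribution function of $X$. Then: (i) $F$ is continuous; (ii) $F$ is strictly increasing on $[0,1]$ if and only if $p_j>0$ for all $j\in\{0,\dots,q-1\}$; (iii) $F'$ exists almost everywhere (with respect to Lebesgue measure) in $[0,1]$.
   Context: The random variable $x_i$ models the outcome of the $i$-th toss of a (possibly unfair) $q$-sided die with faces labelled $0,\dots,q-1$; $X\in[0,1]$ is the number whose base-$q$ digits are the successive outcomes. *)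

(* Defs.v *)
From HB Require Import structures.
From mathcomp Require Import all_boot all_order all_algebra finmap.
From mathcomp Require Import all_classical all_reals all_analysis.
From mathcomp Require Import measurable_realfun.
Import Order.TTheory GRing.Theory Num.Theory.
Import numFieldNormedType.Exports.

Set Implicit Arguments.
Unset Strict Implicit.
Unset Printing Implicit Defensive.

Local Open Scope classical_set_scope.
Local Open Scope ring_scope.

(* Mutual independence, for a family of arbitrary cardinality: the product rule
   is required for every finite subfamily. *)
Definition mutually_independent d d' (T : measurableType d)
    (T' : measurableType d') (R : realType) (P : probability T R)
    (I : choiceType) (x : I -> {RV P >-> T'}) : Prop :=
  forall (J : {fset I}) (A : I -> set T'), (forall i, measurable (A i)) ->
    P (\bigcap_(i in [set` J]) (x i @^-1` A i)) =
    (\prod_(i <- J) P (x i @^-1` A i))%E.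

Section digit_series.
Context d (T : measurableType d) (R : realType) (P : probability T R) (q : nat).
Variable x : nat -> {RV P >-> nat}.

(* The tosses are numbered from 0: [x i] is the (i+1)-st toss, which carries the
   weight q^-(i+1). *)
Definition digit_sum (t : T) : R :=
  limn (series (fun i => (x i t)%:R / q%:R ^+ i.+1 : R)).

(* No bound on the digits is needed: on the set where the series diverges,
   [limn] takes its default value 0. *)
Lemma measurable_digit_sum : measurable_fun setT digit_sum.
Proof.
pose u t i : R := (x i t)%:R / q%:R ^+ i.+1.
have u_ge0 t i : 0 <= u t i by rewrite divr_ge0.
pose E t : \bar R := (\sum_(0 <= i <oo) (u t i)%:E)%E.
have mE : measurable_fun setT E.
  apply: ge0_emeasurable_sum => [i t _ _|i _]; first by rewrite lee_fin.
  apply/measurable_EFinP.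
  by apply: (@measurableT_comp _ _ _ _ _ _
    (fun k : nat => k%:R / q%:R ^+ i.+1 : R)).
apply: (eq_measurable_fun (fine \o E)); last exact: measurableT_comp.
move=> t _ /=; have [cu|ncu] := pselect (cvgn (series (u t))).
  suff -> : E t = (digit_sum t)%:E by [].
  rewrite /digit_sum -EFin_lim//.
  by congr (limn _); apply/funext => n /=; rewrite sumEFin.
have -> : digit_sum t = 0 by rewrite /digit_sum dvgP.
have [//|Et] := eqVneq (E t) +oo%E; first by move->.
case: ncu; apply: nondecreasing_is_cvgn.
  by apply/nondecreasing_series => i _ _; exact: u_ge0.
have fE : E t \is a fin_num.
  by rewrite ge0_fin_numE ?ltey// nneseries_ge0// => i _ _; rewrite lee_fin.
exists (fine (E t)) => _ [n _ <-].
rewrite -lee_fin fineK// /series/= -sumEFin.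
by apply: nneseries_lim_ge => i _ _; rewrite lee_fin.
Qed.

HB.instance Definition _ := isMeasurableFun.Build _ _ _ _ digit_sum
  measurable_digit_sum.

Definition digit_cdf (a : R) : R := fine (cdf (digit_sum : {RV P >-> R}) a).

End digit_series.

(* Main.v *)
Require Import Defs.
From HB Require Import structures.
From mathcomp Require Import all_boot all_order all_algebra finmap.
From mathcomp Require Import all_classical all_reals all_analysis.
From mathcomp Require Import measurable_realfun.
From mathcomp Require Import ring lra zify.
Import Order.TTheory GRing.Theory Num.Theory.
Import numFieldNormedType.Exports.

Set Implicit Arguments.
Unset Strict Implicit.
Unset Printing Implicit Defensive.

Local Open Scope classical_set_scope.
Local Open Scope ring_scope.

(** Cut [[0, 1]] into the [q ^ n] closed cells [[k / q^n, (k + 1) / q^n]].  The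
first [n] tosses, read as the base-[q] numeral [k], put [X] into the [k]-th of
these cells, and by independence the numeral [k] comes up with the probability
[M n k], the product of the weights of its [n] digits.  So the distribution
function [F] is squeezed between partial sums of cell masses (predicate
[cdf_of_cells], established in [digit_cdf_of_cells]): if [K / q^n <= a] then
[\sum_(k < K) M n k <= F a], and if [a < K / q^n] then
[F a <= \sum_(k < K) M n k].  Working with these inequalities avoids having to
know whether [X] charges the endpoints of the cells.  What remains is real
analysis of a function squeezed in this way; a displacement of at most [q^-n]
changes it by no more than the mass of two adjacent cells
([cdf_increment_le], [cdf_modulus]).

- Continuity: [M n k <= c ^ n] where [c < 1] is the largest weight.
- Strict monotonicity: when all weights are positive, every interval [[a, b]]
  contains a cell, of positive mass.  When [p_j = 0], the cell
  [[j / q, (j + 1) / q]] has mass 0 and [F] is constant inside it.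
- Differentiability: if all weights are [1 / q], then [F] is the identity on
  [[0, 1]].  Otherwise [F] is singular: [F' = 0] almost everywhere.  Indeed the
  sum of the square roots of the masses of the cells of level [n] is [s ^ n]
  where [s] is the sum of the [sqrt p_j], and [s < sqrt q] by the equality case
  of the Cauchy-Schwarz inequality.  By Markov's inequality applied to these
  square roots, the cells whose density [q^n M n k] exceeds [c ^ (2 n)] have
  total length at most [(s / (c sqrt q)) ^ n], which is summable for a suitable
  [c < 1].  The same holds, up to a factor 3, after each of these cells is
  enlarged to include its two neighbours.  By Borel-Cantelli almost every [a]
  belongs to finitely many of the enlarged cells, and then the difference
  quotients of [F] at [a] at scale [q^-n] are [O(c ^ (2 n))]
  ([derivable_of_q_adic_increments], [cdf_of_cells_singular]). *)

(** * Masses of the q-adic cells *)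

(** The product of the weights of the [n] base-[q] digits of [k], leading zeros
included; the value at [n = 0] makes it vanish when [k] has more than [n]
digits. *)
Fixpoint cell_mass (R : realType) (q : nat) (p : nat -> R) (n k : nat) : R :=
  if n is m.+1 then cell_mass q p m (k %/ q) * p (k %% q)%N else (k == 0)%:R.

Definition mass_below (R : realType) (q : nat) (p : nat -> R) (n K : nat) : R :=
  \sum_(k < K) cell_mass q p n k.

(** How a distribution function is pinned down by the cell masses without any
reference to the value of the masses of single points.  The bound
[a * q ^ n < K] is strict because all of the mass of a cell may sit at its left
endpoint. *)
Definition cdf_of_cells (R : realType) (q : nat) (p : nat -> R) (F : R -> R) :=
  [/\ {homo F : a b / a <= b}, forall a, 0 <= F a,
      forall n K a, K%:R <= a * q%:R ^+ n -> mass_below q p n K <= F a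
    & forall n K a, a * q%:R ^+ n < K%:R -> F a <= mass_below q p n K].

Lemma exp_lt_eps (R : realType) (z e : R) : 0 <= z < 1 -> 0 < e ->
  exists n, z ^+ n < e.
Proof.
move=> /andP[z0 z1] e0.
have /cvgr0Pnorm_lt/(_ _ e0)[n _ nP] : z ^+ n @[n --> \oo] --> (0 : R).
  by apply: cvg_expr; rewrite ger0_norm.
by exists n; move: (nP n (leqnn n)); rewrite /= ger0_norm ?exprn_ge0.
Qed.

Section cells.
Context (R : realType) (q : nat) (hq : (2 <= q)%N) (p : nat -> R).
Hypothesis p_ge0 : forall j, 0 <= p j.

Local Notation M := (cell_mass q p).
Local Notation G := (mass_below q p).

Let q_gt0 : 0 < q%:R :> R. Proof. by rewrite ltr0n; lia. Qed.
Let qn_gt0 n : 0 < q%:R ^+ n :> R. Proof. by rewrite exprn_gt0. Qed.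
Let q0 : q%:R != 0 :> R. Proof. by rewrite gt_eqF. Qed.
Let qn0 n : q%:R ^+ n != 0 :> R. Proof. by rewrite gt_eqF. Qed.

Lemma mass_belowS n K : G n K.+1 = G n K + M n K.
Proof. by rewrite /mass_below big_ord_recr. Qed.

Lemma cell_mass_ge0 n k : 0 <= M n k.
Proof. by elim: n k => [|n IH] k /=; [case: eqP | exact: mulr_ge0]. Qed.

Lemma cell_mass_le c : (forall j, (j < q)%N -> p j <= c) ->
  forall n k, M n k <= c ^+ n.
Proof.
move=> pc; elim=> [|n IH] k /=; first by rewrite expr0; case: eqP.
rewrite exprSr; apply: ler_pM => //; first exact: cell_mass_ge0.
by apply: pc; rewrite ltn_mod; lia.
Qed.

Lemma cell_mass_out n k : (q ^ n <= k)%N -> M n k = 0.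
Proof.
elim: n k => [|n IH] k /=; first by case: k.
by rewrite expnSr => h; rewrite IH ?mul0r// leq_divRL; lia.
Qed.

Lemma cell_mass_gt0 : (forall j, (j < q)%N -> 0 < p j) ->
  forall n k, (k < q ^ n)%N -> 0 < M n k.
Proof.
move=> pp; elim=> [|n IH] k /=; first by case: k.
rewrite expnSr => h; apply: mulr_gt0; last by apply: pp; rewrite ltn_mod; lia.
by apply: IH; rewrite ltn_divLR; lia.
Qed.

Lemma cell_mass_uniform : (forall j, (j < q)%N -> p j = q%:R^-1) ->
  forall n k, (k < q ^ n)%N -> M n k = (q%:R ^+ n)^-1.
Proof.
move=> pu; elim=> [|n IH] k /=; first by case: k => //; rewrite expr0 invr1.
rewrite expnSr => h; rewrite pu ?ltn_mod; last by lia.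
by rewrite IH ?ltn_divLR ?exprSr ?invfM 1?mulrC//; lia.
Qed.

(** Masses are products over digits, so the sum over all [n]-digit numerals
factors into [n] equal sums over a single digit. *)
Lemma sum_sqrt_cell_mass n :
  \sum_(k < q ^ n) Num.sqrt (M n k) = (\sum_(j < q) Num.sqrt (p j)) ^+ n.
Proof.
elim: n => [|n IH]; first by rewrite expn0 big_ord1 expr0 /= sqrtr1.
rewrite expnSr exprSr -IH -(big_mkord xpredT (fun k => Num.sqrt (M n.+1 k))).
rewrite big_nat_mul big_mkord mulr_suml; apply: eq_bigr => i _.
rewrite mulSn -{1}[(i * q)%N]add0n big_addn addnK big_mkord mulr_sumr.
apply: eq_bigr => j _ /=.
by rewrite addnC divnMDl ?modnMDl ?divn_small ?modn_small ?addn0 ?sqrtrM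
  ?cell_mass_ge0//; lia.
Qed.

(** * Functions squeezed between sums of cell masses *)

Section distribution_function.
Variable F : R -> R.
Hypothesis F_cells : cdf_of_cells q p F.

(** The part of the interval [[a, b]] in the positive half-line has length at most
[q^-n], so it is covered by the cell of its left endpoint and the next one. *)
Lemma cdf_increment_le a b n : a <= b -> b * q%:R ^+ n <= a * q%:R ^+ n + 1 ->
  F b - F a <= M n (Num.truncn (a * q%:R ^+ n)) +
               M n (Num.truncn (a * q%:R ^+ n)).+1.
Proof.
move=> ab hb; have [_ F0 FA FB] := F_cells; set k := Num.truncn _.
have hk : a * q%:R ^+ n < k.+1%:R by rewrite -truncn_le_nat.
have Fa : G n k <= F a.
  have [a0|a0] := leP 0 (a * q%:R ^+ n); first by apply: FA; rewrite truncn_le.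
  (* [Num.truncn] is 0 on negative numbers, and the sum over no cell is 0. *)
  suff -> : k = 0%N by rewrite /mass_below big_ord0.
  by apply/truncn0Pn; rewrite -ltNge; lra.
have : F b <= G n k.+2 by apply: FB; rewrite -[k.+2]addn1 natrD; lra.
by rewrite !mass_belowS; lra.
Qed.

(** The form of the increment bound used both for continuity, where [B] bounds
all masses, and for derivatives, where only the masses of the cell of [x] and
its neighbours are under control.  For [x < 0] nothing locates the two cells, as
truncation sends negative numbers to the cell 0; hence the guard [0 <= x]. *)
Lemma cdf_modulus x y n B : `|y - x| <= (q%:R ^+ n)^-1 ->
  (forall k, (0 <= x -> k%:R - 1 <= x * q%:R ^+ n <= k%:R + 2) -> M n k <= B) ->
  `|F y - F x| <= B + B.
Proof.
move=> xy MB; have [Fm _ _ _] := F_cells.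
suff key a b : a <= b -> b - a <= (q%:R ^+ n)^-1 -> a <= x <= b ->
    F b - F a <= B + B.
  have [le_xy|lt_yx] := leP x y.
    rewrite ger0_norm ?subr_ge0 ?Fm//; apply: key; rewrite ?le_xy ?lexx//.
    by rewrite ger0_norm ?subr_ge0 in xy.
  have le_yx := ltW lt_yx.
  rewrite distrC ger0_norm ?subr_ge0 ?Fm//; apply: key; rewrite ?le_yx ?lexx//.
  by rewrite distrC ger0_norm ?subr_ge0 in xy.
move=> ab hab /andP[ax xb].
have ba1 : b * q%:R ^+ n <= a * q%:R ^+ n + 1.
  by rewrite -(ler_pM2r (qn_gt0 n)) mulVf// mulrBl in hab; lra.
apply: le_trans (cdf_increment_le ab ba1) _; set k := Num.truncn _.
have axn : a * q%:R ^+ n <= x * q%:R ^+ n by rewrite ler_pM2r.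
have xbn : x * q%:R ^+ n <= b * q%:R ^+ n by rewrite ler_pM2r.
have hk : a * q%:R ^+ n < k.+1%:R by rewrite -truncn_le_nat.
have kx : 0 <= x -> k%:R <= x * q%:R ^+ n.
  move=> x0; have [a0|a0] := leP 0 (a * q%:R ^+ n).
    by apply: le_trans axn; rewrite truncn_le.
  suff -> : k = 0%N by rewrite mulr_ge0// ltW.
  by apply/truncn0Pn; rewrite -ltNge; lra.
rewrite -natr1 in hk.
by apply: lerD; apply: MB => /kx {}kx; rewrite -?natr1; apply/andP; split; lra.
Qed.

Lemma cdf_of_cells_continuous c : 0 <= c < 1 ->
  (forall j, (j < q)%N -> p j <= c) -> continuous F.
Proof.
move=> c01 pc x; apply/cvgrPdist_le => e e0.
have [n cn] : exists n, c ^+ n < e / 2 by apply: exp_lt_eps => //; lra.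
near=> y; rewrite distrC.
have : `|F y - F x| <= c ^+ n + c ^+ n.
  apply: (cdf_modulus (n := n)) => [|k _]; last exact: cell_mass_le.
  rewrite distrC; near: y; apply: (@cvgr_dist_le _ _ _ _ _ id) => //.
  by rewrite invr_gt0.
by move: cn; lra.
Unshelve. all: by end_near. Qed.

(** A cell that lies between [a] and [b], at a level where [b - a > 2 q^-n]. *)
Lemma cdf_of_cells_strict_mono : (forall j, (j < q)%N -> 0 < p j) ->
  {in `[0, 1] &, {homo F : a b / a < b}}.
Proof.
move=> pp a b; rewrite !in_itv/= => /andP[a0 a1] /andP[b0 b1] ab.
have [_ _ FA FB] := F_cells.
have [n qn] : exists n, q%:R^-1 ^+ n < (b - a) / 2.
  apply: exp_lt_eps; last lra.
  by rewrite invr_ge0 ltW//= invf_lt1// ltr1n.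
have ban : 2 < (b - a) * q%:R ^+ n.
  by move: qn; rewrite exprVn -[ltLHS]mul1r ltr_pdivrMr//; lra.
pose k := (Num.truncn (a * q%:R ^+ n)).+1.
have hk : a * q%:R ^+ n < k%:R by rewrite -truncn_le_nat.
have kn : k.+1%:R <= b * q%:R ^+ n.
  have : (Num.truncn (a * q%:R ^+ n))%:R <= a * q%:R ^+ n.
    by rewrite truncn_le mulr_ge0// ltW.
  by move: ban; rewrite /k -!natr1; lra.
have : G n k.+1 <= F b by exact: FA.
have : F a <= G n k by exact: FB.
have : 0 < M n k.
  apply: cell_mass_gt0 => //; rewrite -(ler_nat R) natrX.
  by apply: le_trans kn _; rewrite ler_piMl// ltW.
by rewrite mass_belowS; lra.
Qed.

(** The digit [j] has probability 0, so the interior of the [j]-th cell of level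
1 carries no mass.  The witnesses [(j + 1/3) / q] and [(j + 1/2) / q] are
interior points, which keeps clear of a possible point mass at the ends of the
cell. *)
Lemma cdf_of_cells_flat j : (j < q)%N -> p j = 0 ->
  exists a b, [/\ a \in `[0, 1], b \in `[0, 1], a < b & F b <= F a].
Proof.
move=> jq pj0; have [_ _ FA FB] := F_cells.
have j1q : j%:R + 1 <= q%:R :> R by rewrite natr1 ler_nat.
have j0 : 0 <= j%:R :> R by [].
exists ((j%:R + 3^-1) / q%:R), ((j%:R + 2^-1) / q%:R); split.
- by rewrite in_itv/= divr_ge0 ?ler_pdivrMr//=; lra.
- by rewrite in_itv/= divr_ge0 ?ler_pdivrMr//=; lra.
- by rewrite ltr_pM2r ?invr_gt0//; lra.
have : F ((j%:R + 2^-1) / q%:R) <= G 1 j.+1.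
  by apply: FB; rewrite expr1 divfK// -[ltRHS]natr1; lra.
have : G 1 j <= F ((j%:R + 3^-1) / q%:R).
  by apply: FA; rewrite expr1 divfK//; lra.
by rewrite mass_belowS /= divn_small// modn_small// pj0 mulr0 addr0; lra.
Qed.

(** Each cell has mass equal to its length, so [F a] and [a] differ by at most
[q^-n] for every [n]. *)
Lemma cdf_of_cells_uniform : (forall j, (j < q)%N -> p j = q%:R^-1) ->
  {in `[0, 1], F =1 id}.
Proof.
move=> pu a; rewrite in_itv/= => /andP[a0 a1]; have [_ _ FA FB] := F_cells.
have GE n K : (K <= q ^ n)%N -> G n K = K%:R / q%:R ^+ n.
  move=> Kn; rewrite /mass_below (eq_bigr (fun=> (q%:R ^+ n)^-1)).
    by rewrite sumr_const card_ord mulr_natl.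
  by move=> k _; apply: cell_mass_uniform => //; apply: leq_trans Kn.
apply/eqP; rewrite -subr_eq0 -normr_le0; apply/ler_addgt0Pr => e e0.
rewrite add0r.
have [n qn] : exists n, q%:R^-1 ^+ n < e.
  by apply: exp_lt_eps => //; rewrite invr_ge0 ltW//= invf_lt1// ltr1n.
set k := Num.truncn (a * q%:R ^+ n).
have hk : k%:R <= a * q%:R ^+ n by rewrite truncn_le mulr_ge0// ltW.
have hk1 : a * q%:R ^+ n < k.+1%:R by rewrite -truncn_le_nat.
have kn : (k <= q ^ n)%N.
  rewrite -(ler_nat R) natrX; apply: le_trans hk _.
  by rewrite ler_piMl// ltW.
have Fl : a - (q%:R ^+ n)^-1 <= F a.
  have := FA n k a hk; rewrite GE//; apply: le_trans.
  by rewrite ler_pdivlMr// mulrBl mulVf//; move: hk1; rewrite -natr1; lra.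
have Fr : F a <= a + (q%:R ^+ n)^-1.
  have := FB n k.+1 a hk1; rewrite mass_belowS GE// => /le_trans; apply.
  apply: lerD; first by rewrite ler_pdivrMr.
  have [kq|kq] := ltnP k (q ^ n); first by rewrite cell_mass_uniform.
  by rewrite cell_mass_out// invr_ge0 ltW.
apply: le_trans (ltW qn); rewrite exprVn ler_norml; apply/andP; split; lra.
Qed.

End distribution_function.
End cells.

(** * Differentiability almost everywhere *)

(** Each small [h] satisfies [q^-(n+1) < |h| <= q^-n] for one large [n]; the
increment bound at scale [n] then makes the difference quotient at most
[2 q z^n].  So the derivative is 0. *)
Lemma derivable_of_q_adic_increments (R : realType) (q : nat) (F : R -> R)
    (a z : R) (N : nat) : (2 <= q)%N -> 0 <= z < 1 ->
  (forall n y, (N <= n)%N -> `|y - a| <= (q%:R ^+ n)^-1 ->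
     `|F y - F a| <= 2 * z ^+ n / q%:R ^+ n) ->
  derivable F a 1.
Proof.
move=> hq z01 incr; have /andP[z0 z1] := z01.
have q_gt0 : 0 < q%:R :> R by rewrite ltr0n; lia.
have qn_gt0 n : 0 < q%:R ^+ n :> R by rewrite exprn_gt0.
apply/cvg_ex; exists 0; apply/cvgrPdist_le => e e0.
have [m zm] : exists m, z ^+ m < e / (2 * q%:R).
  by apply: exp_lt_eps => //; rewrite divr_gt0// mulr_gt0.
pose m' := maxn N m.
near=> h; rewrite sub0r normrN.
have h0 : 0 < `|h| by rewrite normr_gt0; near: h; exact: nbhs_dnbhs_neq.
have hm : `|h| <= (q%:R ^+ m')^-1.
  by near: h; apply: dnbhs0_le; rewrite invr_gt0.
have [n mn /andP[hn1 hn]] : exists2 n, (m' <= n)%N &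
    (q%:R ^+ n.+1)^-1 < `|h| <= (q%:R ^+ n)^-1.
  have ex : exists n, (q%:R ^+ n)^-1 < `|h|.
    have [n qn] : exists n, q%:R^-1 ^+ n < `|h|.
      apply: exp_lt_eps => //.
      by rewrite invr_ge0 ltW//= invf_lt1// ltr1n.
    by exists n; rewrite -exprVn.
  case: (ex_minnP ex) => k hk kmin.
  have mk : (m' < k)%N.
    rewrite ltnNge; apply/negP => km; move: (lt_le_trans hk hm).
    by rewrite ltf_pV2 ?posrE// ltr_eXn2l ?ltr1n// ltnNge km.
  case: k mk hk kmin => // k mk hk kmin; exists k; rewrite ?hk//=.
  by rewrite leNgt; apply/negP => /kmin; rewrite ltnn.
rewrite normrZ normfV ler_pdivrMl//.
apply: le_trans (incr n _ _ _) _; first exact: leq_trans (leq_maxl _ _) mn.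
  by rewrite addrK [_ *: _]mulr1.
have zn : z ^+ n <= e / (2 * q%:R).
  apply: le_trans (ltW zm); apply: ler_wiXn2l => //; first exact: ltW.
  exact: leq_trans (leq_maxr _ _) mn.
have -> : 2 * z ^+ n / q%:R ^+ n = 2 * q%:R * z ^+ n * (q%:R ^+ n.+1)^-1.
  by rewrite exprS; field; rewrite !gt_eqF.
rewrite mulrC; apply: ler_pM; first by rewrite invr_ge0 ltW.
- by rewrite !mulr_ge0 ?exprn_ge0// ltW.
- exact: ltW.
- by rewrite mulrC -ler_pdivlMr// mulr_gt0.
Unshelve. all: by end_near. Qed.

Section singular.
Context (R : realType) (q : nat) (hq : (2 <= q)%N) (p : nat -> R).
Hypothesis p_ge0 : forall j, 0 <= p j.
Hypothesis p_sum1 : \sum_(j < q) p j = 1.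

Local Notation M := (cell_mass q p).
Local Notation r := (Num.sqrt (q%:R : R)).
Local Notation s := (\sum_(j < q) Num.sqrt (p j)).

(** Strict Cauchy-Schwarz inequality between [(sqrt p_j)_j] and the constant
vector: the sum of the squares of [sqrt p_j - 1 / sqrt q] is [2 - 2 s / r],
and it is positive as soon as one weight differs from [1 / q]. *)
Lemma sum_sqrt_lt j : (j < q)%N -> p j != q%:R^-1 -> s / r < 1.
Proof.
move=> jq pj.
have q_gt0 : 0 < q%:R :> R by rewrite ltr0n; lia.
have r0 : 0 < r by rewrite sqrtr_gt0.
have r2 : r ^+ 2 = q%:R by rewrite sqr_sqrtr// ltW.
have sumE : \sum_(i < q) (Num.sqrt (p i) - r^-1) ^+ 2 = 2 - 2 * (s / r).
  under eq_bigr do rewrite sqrrB sqr_sqrtr//.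
  rewrite big_split/= sumrB p_sum1 sumr_const card_ord exprVn r2.
  rewrite -(mulr_natr q%:R^-1) mulVf ?gt_eqF// sumrMnl -mulr_suml.
  by ring.
suff : 0 < \sum_(i < q) (Num.sqrt (p i) - r^-1) ^+ 2 by rewrite sumE; lra.
rewrite (bigD1 (Ordinal jq))//=.
apply: ltr_pwDl; last by apply: sumr_ge0 => i _; rewrite sqr_ge0.
rewrite lt_def sqr_ge0 sqrf_eq0 andbT subr_eq0; apply: contra pj => /eqP pj.
by rewrite -(sqr_sqrtr (p_ge0 j)) pj exprVn r2.
Qed.

(** The condition says that the density [q^n M n k] of the cell exceeds
[c^(2 n)].  The interval is the cell enlarged by its two neighbours, so that a
point outside of it also keeps away from the heavy cells next to its own. *)
Definition heavy_cell (c : R) (n k : nat) : set R :=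
  if c ^+ n < r ^+ n * Num.sqrt (M n k)
  then `[(k%:R - 1) / q%:R ^+ n, (k%:R + 2) / q%:R ^+ n]%classic else set0.

Definition heavy_cover (c : R) (n : nat) : set R :=
  \big[setU/set0]_(k < q ^ n) heavy_cell c n k.

Lemma measurable_heavy_cell c n k : measurable (heavy_cell c n k).
Proof. by rewrite /heavy_cell; case: ifP. Qed.

Lemma measurable_heavy_cover c n : measurable (heavy_cover c n).
Proof. by apply: bigsetU_measurable => k _; exact: measurable_heavy_cell. Qed.

(** Markov's inequality: each heavy cell contributes the length [3 q^-n], at
most [3 q^-n (r^n sqrt (M n k) / c^n)], and these bounds sum to the right-hand
side by [sum_sqrt_cell_mass]. *)
Lemma heavy_cover_measure c n : 0 < c ->
  (lebesgue_measure (heavy_cover c n) <= (3 * (s / r / c) ^+ n)%:E)%E.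
Proof.
move=> c0.
have q_gt0 : 0 < q%:R :> R by rewrite ltr0n; lia.
have r0 : 0 < r by rewrite sqrtr_gt0.
have r2 : r ^+ 2 = q%:R by rewrite sqr_sqrtr// ltW.
have qn_gt0 : 0 < q%:R ^+ n :> R by rewrite exprn_gt0.
have rn_gt0 : 0 < r ^+ n by rewrite exprn_gt0.
have cn_gt0 : 0 < c ^+ n by rewrite exprn_gt0.
apply: (@le_trans _ _
    (\sum_(k < q ^ n) lebesgue_measure (heavy_cell c n k))%E).
  by apply: le_mu_bigsetU => k _; exact: measurable_heavy_cell.
have -> : 3 * (s / r / c) ^+ n =
    \sum_(k < q ^ n) 3 / q%:R ^+ n * (r ^+ n * Num.sqrt (M n k) / c ^+ n).
  rewrite -mulr_sumr -mulr_suml -mulr_sumr sum_sqrt_cell_mass//.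
  have -> : q%:R ^+ n = r ^+ n * r ^+ n by rewrite -exprMn -expr2 r2.
  by rewrite !exprMn !exprVn; field; rewrite !gt_eqF.
rewrite -sumEFin; apply: lee_sum => k _.
rewrite /heavy_cell; case: ifPn => [big|_].
  rewrite lebesgue_measure_itv/= lte_fin ltr_pM2r ?invr_gt0//.
  rewrite ifT; last by lra.
  rewrite EFinN -EFinD lee_fin -mulrBl.
  have -> : k%:R + 2 - (k%:R - 1) = 3 :> R by ring.
  rewrite ler_peMr ?divr_ge0 ?ltW//.
  by rewrite ltr_pdivlMr// mul1r.
rewrite measure0 lee_fin mulr_ge0 ?divr_ge0 ?mulr_ge0 ?sqrtr_ge0//.
all: by rewrite ltW.
Qed.

Lemma cell_mass_le_off_heavy_cover c n x k : 0 <= c -> ~ heavy_cover c n x ->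
  k%:R - 1 <= x * q%:R ^+ n <= k%:R + 2 -> M n k <= (c ^+ 2) ^+ n / q%:R ^+ n.
Proof.
move=> c0 xA /andP[kx xk].
have q_gt0 : 0 < q%:R :> R by rewrite ltr0n; lia.
have qn_gt0 : 0 < q%:R ^+ n :> R by rewrite exprn_gt0.
have r2 : r ^+ 2 = q%:R by rewrite sqr_sqrtr// ltW.
have [kq|kq] := ltnP k (q ^ n); last first.
  by rewrite cell_mass_out// divr_ge0 ?exprn_ge0// ltW.
have M0 : 0 <= M n k by exact: cell_mass_ge0.
have qr : q%:R ^+ n = (r ^+ n) ^+ 2 by rewrite exprAC r2.
rewrite ler_pdivlMr// -(sqr_sqrtr M0) qr -exprMn [leRHS]exprAC.
rewrite ler_sqr ?nnegrE ?mulr_ge0 ?exprn_ge0 ?sqrtr_ge0//.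
rewrite leNgt mulrC; apply/negP => big; apply: xA.
rewrite /heavy_cover -bigcup_mkord; exists k => //=.
by rewrite /heavy_cell big /= in_itv/= ler_pdivrMr// ler_pdivlMr// kx.
Qed.

(** Borel-Cantelli for the sets [heavy_cover c n], whose measures are dominated
by a geometric series for any [c] between [s / r] and 1; the midpoint is one. *)
Lemma cdf_of_cells_singular (F : R -> R) j : cdf_of_cells q p F ->
  (j < q)%N -> p j != q%:R^-1 ->
  {ae @lebesgue_measure R, forall a, a \in `[0, 1] -> derivable F a 1}.
Proof.
move=> F_cells jq pj; have s1 := sum_sqrt_lt jq pj.
have s0 : 0 <= s / r.
  by rewrite divr_ge0 ?sqrtr_ge0// sumr_ge0// => i _; rewrite sqrtr_ge0.
pose c := (s / r + 1) / 2.
have c01 : 0 <= c < 1 by apply/andP; split; rewrite /c; lra.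
have c0 : 0 < c by rewrite /c; lra.
have sc : `|s / r / c| < 1.
  rewrite ger0_norm ?(divr_ge0 s0 (ltW c0))// ltr_pdivrMr// mul1r /c; lra.
exists (lim_sup_set (heavy_cover c)); split.
- apply: bigcapT_measurable => n; apply: bigcup_measurable => k _.
  exact: measurable_heavy_cover.
- apply: lim_sup_set_cvg0 => [n|]; first exact: measurable_heavy_cover.
  apply: (@le_lt_trans _ _
      (\sum_(0 <= n <oo) (geometric 3 (s / r / c) n)%:E)%E).
    by apply: lee_nneseries => // n _; exact: heavy_cover_measure.
  have cg := is_cvg_geometric_series (a := 3) sc.
  rewrite (_ : (fun n => _) = EFin \o series (geometric 3 (s / r / c))).
    by rewrite EFin_lim// ltry.
  by apply/funext => n /=; rewrite sumEFin.
move=> a; apply: contra_notP => /= aA.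
rewrite in_itv/= => /andP[a0 a1].
have [N NA] : exists N, forall n, (N <= n)%N -> ~ heavy_cover c n a.
  apply: contra_notP aA => /forallNP aA N _.
  have /existsNP[n /not_implyP[Nn /contrapT nA]] := aA N.
  by exists n.
apply: (@derivable_of_q_adic_increments _ q _ _ (c ^+ 2) N) => //.
  by rewrite sqr_ge0 exprn_ilt1// ?ltW//; case/andP: c01.
move=> n y Nn ya; rewrite -mulrA mulr_natl mulr2n.
apply: (cdf_modulus hq F_cells ya) => k kx.
exact: (cell_mass_le_off_heavy_cover (ltW c0) (NA n Nn) (kx a0)).
Qed.

End singular.

(** * The digits of the random number *)

Section tosses.
Context d (T : measurableType d) (R : realType) (P : probability T R).
Context (q : nat) (hq : (2 <= q)%N) (p : nat -> R).
Variable x : nat -> {RV P >-> nat}.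
Hypothesis x_lt : forall i t, (x i t < q)%N.
Hypothesis x_indep : mutually_independent x.
Hypothesis x_law : forall i j, P [set t | x i t = j] = (p j)%:E.

Local Notation M := (cell_mass q p).
Local Notation G := (mass_below q p).
Local Notation X := (digit_sum q x).

Let q_gt0 : 0 < q%:R :> R. Proof. by rewrite ltr0n; lia. Qed.
Let qn_gt0 n : 0 < q%:R ^+ n :> R. Proof. by rewrite exprn_gt0. Qed.

(** The integer with base-[q] digits [x_0, ..., x_(n-1)], leading digit first. *)
Fixpoint prefix_code (n : nat) (t : T) : nat :=
  if n is m.+1 then (prefix_code m t * q + x m t)%N else 0%N.

Lemma series_digits t n : series (fun i => (x i t)%:R / q%:R ^+ i.+1 : R) n =
  (prefix_code n t)%:R / q%:R ^+ n.
Proof.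
elim: n => [|n IH]; first by rewrite /series/= big_geq// mul0r.
move: IH; rewrite /series/= big_nat_recr//= => ->; rewrite natrD natrM exprS.
by field; rewrite !gt_eqF.
Qed.

Lemma prefix_code_lt n t : (prefix_code n t < q ^ n)%N.
Proof.
elim: n => [|n IH] //=; rewrite expnSr.
by have := x_lt n t; nia.
Qed.

(** The right endpoints of the successive cells containing [X t] decrease; this
bounds the partial sums of the digit series from above. *)
Lemma prefix_code_tail n m t : (n <= m)%N ->
  (prefix_code m t).+1%:R / q%:R ^+ m <=
  (prefix_code n t).+1%:R / q%:R ^+ n :> R.
Proof.
move=> nm; rewrite -(subnK nm); elim: (m - n)%N => // {nm}m' IH.
apply: le_trans IH; rewrite addSn ler_pdivrMr//.
rewrite exprS [q%:R * _]mulrC mulrA divfK ?gt_eqF//= -natrM ler_nat.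
by have := x_lt (m' + n) t; nia.
Qed.

Lemma digit_sum_bounds n t :
  (prefix_code n t)%:R <= X t * q%:R ^+ n <= (prefix_code n t).+1%:R.
Proof.
pose u i : R := (x i t)%:R / q%:R ^+ i.+1.
have u_ndecr : nondecreasing_seq (series u).
  by apply/nondecreasing_series => i _ _; rewrite divr_ge0// ltW.
have le_tail m : (n <= m)%N ->
    series u m <= (prefix_code n t).+1%:R / q%:R ^+ n.
  move=> nm; apply: le_trans (prefix_code_tail t nm).
  by rewrite series_digits ler_pM2r ?invr_gt0// ler_nat.
have cu : cvgn (series u).
  apply: nondecreasing_is_cvgn => //.
  exists ((prefix_code n t).+1%:R / q%:R ^+ n) => _ [m _ <-].
  have [nm|mn] := leqP n m; first exact: le_tail.
  by apply: le_trans (le_tail n (leqnn n)); exact/u_ndecr/ltnW.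
apply/andP; split.
  rewrite -ler_pdivrMr// -series_digits.
  exact: (nondecreasing_cvgn_le u_ndecr cu).
rewrite -ler_pdivlMr//.
by apply: limr_le => //; exists n => // m /= nm; exact: le_tail.
Qed.

(** A numeral determines its digits: this turns an event on the prefix code into
an intersection of events on single tosses, the form to which mutual
independence applies. *)
Lemma prefix_code_cylinder n k : (k < q ^ n)%N ->
  exists2 w : nat -> nat,
    (forall t, prefix_code n t = k <-> forall i, (i < n)%N -> x i t = w i) &
    \prod_(i < n) p (w i) = M n k.
Proof.
elim: n k => [|n IH] k.
  rewrite expn0 ltnS leqn0 => /eqP ->.
  by exists (fun=> 0%N) => //; rewrite big_ord0.
rewrite expnSr => kq.
have [|w wP wM] := IH (k %/ q)%N; first by rewrite ltn_divLR; lia.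
exists (fun i => if i == n then (k %% q)%N else w i).
  move=> t /=; split => [tk i|tw].
    have xn := x_lt n t.
    rewrite ltnS leq_eqVlt => /predU1P[->|i_n].
      by rewrite eqxx -tk modnMDl modn_small.
    rewrite ltn_eqF//; move: i i_n; apply/wP.
    by rewrite -tk divnMDl ?divn_small ?addn0//; lia.
  rewrite [k in RHS](divn_eq k q); congr (_ * _ + _)%N.
    by apply/wP => i i_n; rewrite tw ?ltn_eqF//; exact: ltnW.
  by rewrite tw// eqxx.
rewrite big_ord_recr/= eqxx -wM; congr (_ * _).
by apply: eq_bigr => i _; rewrite ltn_eqF.
Qed.

Lemma prob_prefix_code n k :
  measurable [set t | prefix_code n t = k] /\
  P [set t | prefix_code n t = k] = (M n k)%:E.
Proof.
have [kq|kq] := ltnP k (q ^ n); last first.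
  have -> : [set t | prefix_code n t = k] = set0.
    by apply/seteqP; split => // t /= tk; have := prefix_code_lt n t; lia.
  by rewrite measure0 cell_mass_out.
have [w wP <-] := prefix_code_cylinder kq.
pose J : {fset nat} := [fset i in iota 0 n]%fset.
have JE i : (i \in J) = (i < n)%N by rewrite inE/= mem_iota add0n.
have -> : [set t | prefix_code n t = k] =
    \bigcap_(i in [set` J]) (x i @^-1` [set w i]).
  apply/seteqP; split => t /=.
    by move=> /wP h i; rewrite /= JE; exact: h.
  by move=> h; apply/wP => i i_n; apply: h; rewrite /= JE.
split.
  by apply: fin_bigcap_measurable => // i _; exact: measurable_funPTI.
rewrite (@x_indep J (fun i => [set w i]))// -prodEFin.
rewrite (perm_big (iota 0 n)).
  rewrite -[n in iota 0 n]subn0 big_mkord.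
  by apply: eq_bigr => i _; rewrite -(x_law i).
by apply: uniq_perm; rewrite ?fset_uniq ?iota_uniq// => i; rewrite JE mem_iota.
Qed.

Lemma prob_prefix_code_lt n K :
  measurable [set t | (prefix_code n t < K)%N] /\
  P [set t | (prefix_code n t < K)%N] = (G n K)%:E.
Proof.
elim: K => [|K [mK IH]].
  have -> : [set t | (prefix_code n t < 0)%N] = set0 by apply/seteqP; split.
  by rewrite measure0 /mass_below big_ord0.
have [mk Pk] := prob_prefix_code n K.
have -> : [set t | (prefix_code n t < K.+1)%N] =
    [set t | (prefix_code n t < K)%N] `|` [set t | prefix_code n t = K].
  apply/seteqP; split => t /=; last by lia.
  by rewrite ltnS leq_eqVlt => /predU1P[]; [right|left].
split; first exact: measurableU.
rewrite mass_belowS EFinD -IH -Pk measureU//.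
by apply/seteqP; split => // t /= [] /[swap] ->; rewrite ltnn.
Qed.

Lemma digit_cdf_of_cells : cdf_of_cells q p (digit_cdf q x).
Proof.
have mX a : measurable (X @^-1` `]-oo, a]).
  by rewrite -[X in measurable X]setTI; exact: measurable_digit_sum.
have FE a : (digit_cdf q x a)%:E = P (X @^-1` `]-oo, a]).
  by rewrite /digit_cdf fineK// fin_num_measure.
split=> [a b ab|a|n K a Ka|n K a aK]; rewrite -lee_fin ?FE//.
- apply: le_measure; rewrite ?inE// => t /=.
  by rewrite !in_itv/= => /le_trans; exact.
- have [mK <-] := prob_prefix_code_lt n K.
  apply: le_measure; rewrite ?inE// => t /= tK; rewrite in_itv/=.
  have /andP[_ h] := digit_sum_bounds n t.
  rewrite -(ler_pM2r (qn_gt0 n)); apply: le_trans h (le_trans _ Ka).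
  by rewrite ler_nat.
- have [mK <-] := prob_prefix_code_lt n K.
  apply: le_measure; rewrite ?inE// => t /=; rewrite in_itv/= => ta.
  have /andP[h _] := digit_sum_bounds n t.
  rewrite -(ltr_nat R); apply: le_lt_trans h (le_lt_trans _ aK).
  by rewrite ler_pM2r.
Qed.

End tosses.

(** * The theorem *)

Theorem theorem3p1 (d : measure_display) (T : measurableType d) (R : realType)
  (P : probability T R) (q : nat) (hq : (2 <= q)%N) (p : 'I_q -> R)
  (p_ge0 : forall j, 0 <= p j) (p_sum1 : \sum_(j < q) p j = 1)
  (p_neq1 : forall j, p j <> 1)
  (x : nat -> {RV P >-> nat}) (x_lt : forall i t, (x i t < q)%N)
  (x_indep : mutually_independent x)
  (x_law : forall i (j : 'I_q), P [set t | x i t = j] = (p j)%:E) :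
  [/\ continuous (digit_cdf q x),
      {in `[0, 1] &, {homo digit_cdf q x : a b / a < b}} <->
        (forall j, 0 < p j)
    & {ae @lebesgue_measure R,
        forall a, a \in `[0, 1] -> derivable (digit_cdf q x) a 1}].
Proof.
(* The weights are extended by 0 to all natural numbers, the type in which the
   tosses and the digits of a numeral take their values. *)
pose p' (k : nat) : R := oapp p 0 (insub k).
have p'E (j : 'I_q) : p' j = p j by rewrite /p' valK.
have p'_ge0 k : 0 <= p' k by rewrite /p'; case: insubP => [j _ _|_] /=.
have p'_sum1 : \sum_(j < q) p' j = 1.
  by rewrite -p_sum1; apply: eq_bigr => j _; rewrite p'E.
have p'_law i k : P [set t | x i t = k] = (p' k)%:E.
  rewrite /p'; case: insubP => [j _ <-|kq] /=; first exact: x_law.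
  suff -> : [set t | x i t = k] = set0 by rewrite measure0.
  apply/seteqP; split => // t /= xk; move: kq; rewrite -xk.
  by rewrite x_lt.
have F_cells : cdf_of_cells q p' (digit_cdf q x) by exact: digit_cdf_of_cells.
split.
- pose c := \big[Num.max/0]_(j < q) p j.
  apply: (cdf_of_cells_continuous hq p'_ge0 F_cells (c := c)).
    rewrite /c; apply/andP; split; first exact: bigmax_ge_id.
    apply: bigmax_lt => // j _; rewrite lt_neqAle; apply/andP; split.
      exact/eqP.
    by rewrite -p_sum1 (bigD1 j)//= lerDl sumr_ge0.
  by move=> j jq; rewrite -[j]/(val (Ordinal jq)) p'E; exact: le_bigmax.
- split=> [Fmono j|p_gt0].
    rewrite lt_neqAle p_ge0 andbT; apply/eqP => pj0.
    have [|a [b [a01 b01 ab]]] := cdf_of_cells_flat hq F_cells (ltn_ord j).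
      by rewrite p'E.
    by rewrite leNgt Fmono.
  apply: (cdf_of_cells_strict_mono hq F_cells) => j jq.
  by rewrite -[j]/(val (Ordinal jq)) p'E.
- have [pu|] := pselect (forall j, (j < q)%N -> p' j = q%:R^-1); last first.
    move=> /existsNP[j /not_implyP[jq /eqP pj]].
    exact: (cdf_of_cells_singular hq p'_ge0 p'_sum1 F_cells jq pj).
  (* At 0 and 1 the derivative from outside [[0, 1]] differs from the one from
     inside, so these two points form the exceptional set. *)
  have Fid := cdf_of_cells_uniform hq F_cells pu.
  exists ([set 0] `|` [set 1]); split.
  + exact: measurableU.
  + rewrite measureU//= ?lebesgue_measure_set1 ?adde0//.
    by apply/seteqP; split => // t /= [-> /eqP]; rewrite eq_sym oner_eq0.
  move=> a; apply: contra_notP => /= a01.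
  rewrite in_itv/= => /andP[a0 a1].
  have [a0' a1'] : 0 < a /\ a < 1.
    split; rewrite lt_neqAle ?a0 ?a1 andbT; apply/eqP => ea; apply: a01.
      by left.
    by right.
  have near_id : \forall y \near a, id y = digit_cdf q x y.
    near=> y; rewrite Fid// in_itv/=; apply/andP; split; apply/ltW.
      by near: y; exact: lt_nbhsr.
    by near: y; exact: lt_nbhsl.
  apply: near_eq_derivable near_id _ => //.
Unshelve. all: by end_near. Qed.
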